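(* Let $\mathcal{H}$ be a Hilbert space, and let $A=\{A_a\}_{a\in\Omega_A}$ and $B=\{B_b\}_{b\in\Omega_B}$ be POVMs on $\mathcal{H}$ with finite outcome sets. For any POVM $F=\{F_x\}_{x\in\Omega}$ on $\mathcal{H}$ with finite outcome set $\Omega$ and any functions $f_A:\Omega\to\Omega_A$ and $f_B:\Omega\to\Omega_B$, $$2D_{d_\infty}(A,f_A(F))\,D_{d_\infty}(B,f_B(F))+D_{d_\infty}(A,f_A(F))+D_{d_\infty}(B,f_B(F))$$ $$+2\bigl(2D_{d_\infty}(A,f_A(F))+V(A)\bigr)^{1/2}\bigl(2D_{d_\infty}(B,f_B(F))+V(B)\bigr)^{1/2}\ \ge\ \max_{a\in\Omega_A,\,b\in\Omega_B}\Vert[A_a,B_b]\Vert,$$ where $V(A):=\max_{a\in\Omega_A}\Vert A_a-A_a^2\Vert$ and $V(B):=\max_{b\in\Omega_B}\Vert B_b-B_b^2\Vert$.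
   Context: $\mathcal{H}$ is a (nonzero, complex) Hilbert space, $\Vert\cdot\Vert$ is the operator norm on $\mathbf{B}(\mathcal{H})$, and $[X,Y]=XY-YX$. A positive operator valued measure (POVM) with finite outcome set $\Omega$ is a family $F=\{F_x\}_{x\in\Omega}$ of bounded operators on $\mathcal{H}$ with $0\le F_x\le\mathbf{1}$ and $\sum_{x\in\Omega}F_x=\mathbf{1}$. For a function $f:\Omega\to\Omega'$ ($\Omega'$ finite), $f(F)=\{f(F)_y\}_{y\in\Omega'}$ is the POVM $f(F)_y:=\sum_{x\in\Omega:\,f(x)=y}F_x$. For a state $\omega$ (positive linear functional on $\mathbf{B}(\mathcal{H})$ with $\omega(\mathbf{1})=1$), $P^\omega_A(a):=\omega(A_a)$. For probability distributions $p,q$ on a finite set $\Omega$, $d_\infty(p,q):=\max_{x\in\Omega}|p(x)-q(x)|$. For POVMs $A,A'$ with the same finite outcome set, $D_{d_\infty}(A,A'):=\sup_\omega d_\infty(P^\omega_A,P^\omega_{A'})$, the supremum being over all states; equivalently $D_{d_\infty}(A,A')=\max_a\Vert A_a-A'_a\Vert$. *)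

(* Defs.v *)
From HB Require Import structures.
From mathcomp Require Import all_boot all_order all_algebra.
From mathcomp Require Import complex.
From mathcomp Require Import boolp classical_sets functions reals.
From mathcomp Require Import topology normedtype.

Set Implicit Arguments.
Unset Strict Implicit.
Unset Printing Implicit Defensive.

Import Order.TTheory GRing.Theory Num.Theory.
Import numFieldNormedType.Exports.

Local Open Scope classical_set_scope.
Local Open Scope ring_scope.

(* Complex Hilbert spaces.  The inner product is linear in its first argument
   and conjugate-linear in the second; the norm, like every norm on a module
   over R[i] in this library, takes values in R[i]. *)
HB.mixin Record isHilbert (R : realType) H & CompleteNormedModule R[i] H := {
  inner : {dot H for @Num.conj R[i]};
  inner_norm : forall x : H, inner x x = `|x| ^+ 2
}.

#[short(type="hilbertType")]
HB.structure Definition Hilbert (R : realType) :=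
  { H of isHilbert R H & CompleteNormedModule R[i] H }.

Section BoundedOperators.
Variables (R : realType) (H : hilbertType R).

Definition is_bounded_op : pred (H -> H) := fun T =>
  `[< linear T /\ exists M : R[i], forall x, `|T x| <= M * `|x| >].

Record bop := Bop { bop_fun :> H -> H ; bopP : is_bounded_op bop_fun }.

HB.instance Definition _ := [isSub for bop_fun].
HB.instance Definition _ := [Choice of bop by <:].

Lemma bop_linear (T : bop) : linear T.
Proof. by case/asboolP: (bopP T). Qed.

Lemma bop_bounded (T : bop) : exists M : R[i], forall x, `|T x| <= M * `|x|.
Proof. by case/asboolP: (bopP T). Qed.

HB.instance Definition _ (T : bop) :=
  GRing.isLinear.Build R[i] H H *:%R (bop_fun T) (bop_linear T).

Lemma bop_ext (S T : bop) : (forall x, S x = T x) -> S = T.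
Proof. by move=> ST; apply/val_inj/funext. Qed.

Lemma bop_submod_closed : submod_closed is_bounded_op.
Proof.
split=> [|a f g].
  apply/asboolP; split=> [b u v|]; first by rewrite /= scaler0 addr0.
  by exists 0 => x; rewrite mul0r normr0.
move=> /asboolP[lf [M fM]] /asboolP[lg [N gN]]; apply/asboolP; split.
  move=> b u v; rewrite -[LHS]/(a *: f (b *: u + v) + g (b *: u + v)) lf lg.
  rewrite -[RHS]/(b *: (a *: f u + g u) + (a *: f v + g v)).
  by rewrite !scalerDr !scalerA [a * b]mulrC addrACA.
exists (`|a| * M + N) => x; rewrite -[X in `|X|]/(a *: f x + g x).
rewrite (le_trans (ler_normD _ _))// mulrDl lerD// normrZ -mulrA.
exact: ler_wpM2l.
Qed.

HB.instance Definition _ :=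
  GRing.isSubmodClosed.Build R[i] (H -> H) is_bounded_op bop_submod_closed.
HB.instance Definition _ := [SubChoice_isSubLmodule of bop by <:].

Lemma bop_id_subproof : is_bounded_op (@id H).
Proof. by apply/asboolP; split=> //; exists 1 => x; rewrite mul1r. Qed.

Lemma bop_comp_subproof (S T : bop) : is_bounded_op (S \o T).
Proof.
apply/asboolP; split=> [a u v|]; first by rewrite /= !linearP.
have [[M SM] [N TN]] := (bop_bounded S, bop_bounded T).
exists (`|M| * N) => x /=; rewrite (le_trans (SM _))//.
have [->|Tx0] := eqVneq (T x) 0.
  by rewrite normr0 mulr0 -mulrA mulr_ge0// (le_trans _ (TN x)).
have Mge0 : 0 <= M.
  by rewrite -(pmulr_lge0 M (_ : 0 < `|T x|)) ?normr_gt0// (le_trans _ (SM _)).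
by rewrite ger0_norm// -mulrA ler_wpM2l.
Qed.

Definition bop_id : bop := Bop bop_id_subproof.
Definition bop_comp (S T : bop) : bop := Bop (bop_comp_subproof S T).

(* B(H) as a possibly trivial ring: multiplication is composition. *)
Fact bop_compA : associative bop_comp.
Proof. by move=> S T U; apply: bop_ext. Qed.
Fact bop_comp1l : left_id bop_id bop_comp.
Proof. by move=> S; apply: bop_ext. Qed.
Fact bop_comp1r : right_id bop_id bop_comp.
Proof. by move=> S; apply: bop_ext. Qed.
Fact bop_compDl : left_distributive bop_comp +%R.
Proof. by move=> S T U; apply: bop_ext. Qed.
Fact bop_compDr : right_distributive bop_comp +%R.
Proof. by move=> S T U; apply: bop_ext => x; exact: linearD. Qed.

HB.instance Definition _ := GRing.Zmodule_isPzRing.Build bop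
  bop_compA bop_comp1l bop_comp1r bop_compDl bop_compDr.

Definition opnorm (T : bop) : R :=
  sup [set complex.Re `|T x| | x in [set x : H | `|x| <= 1]].

Definition commutator (S T : bop) : bop := S * T - T * S.

(* The order of R[i] makes [0 <= z] mean that z is real and nonnegative, so on a
   complex Hilbert space this forces T to be self-adjoint. *)
Definition posop (T : bop) : Prop := forall x : H, 0 <= inner (T x) x.

Definition leop (S T : bop) : Prop := posop (T - S).

Record povm (X : finType) := POVM {
  effect :> X -> bop ;
  effect_ge0 : forall x, leop 0 (effect x) ;
  effect_le1 : forall x, leop (effect x) 1 ;
  effect_sum : \sum_x effect x = 1
}.

Lemma posop_sum (I : finType) (P : pred I) (F : I -> bop) :
  (forall i, P i -> posop (F i)) -> posop (\sum_(i | P i) F i).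
Proof.
move=> F0; elim/big_ind: _ => // [x|S T S0 T0 x].
  by rewrite -[(0 : bop) x]/0 linear0l.
by rewrite -[(S + T) x]/(S x + T x) linearDl; exact: addr_ge0 (S0 x) (T0 x).
Qed.

Section Pushforward.
Variables (X Y : finType) (f : X -> Y) (F : povm X).

Definition pushforward_fun (y : Y) : bop := \sum_(x | f x == y) F x.

Lemma povm_posop x : posop (F x).
Proof. by have := effect_ge0 F x; rewrite /leop subr0. Qed.

Fact pushforward_ge0 y : leop 0 (pushforward_fun y).
Proof. by rewrite /leop subr0; apply: posop_sum => x _; exact: povm_posop. Qed.

Fact pushforward_le1 y : leop (pushforward_fun y) 1.
Proof.
rewrite /leop -(effect_sum F) (bigID (fun x => f x == y) xpredT) /=.
rewrite -/(pushforward_fun y) [pushforward_fun y + _]addrC addrK.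
by apply: posop_sum => x _; exact: povm_posop.
Qed.

Fact pushforward_sum : \sum_y pushforward_fun y = 1.
Proof. by rewrite -(effect_sum F) (partition_big f xpredT). Qed.

Definition pushforward : povm Y :=
  POVM pushforward_ge0 pushforward_le1 pushforward_sum.

End Pushforward.

Record state := State {
  state_fun :> {scalar bop} ;
  state_ge0 : forall T, posop T -> 0 <= state_fun T ;
  state1 : state_fun 1 = 1
}.

(* [w (A a)] is a nonnegative real, being the value of a state at a positive
   operator; [complex.Re] only changes its type. *)
Definition outcome_dist (w : state) (X : finType) (A : povm X) (a : X) : R :=
  complex.Re (w (A a)).

(* All maxima below are of nonnegative numbers over a finite type, nonempty
   as soon as it carries a POVM on a nonzero space, so 0 is a neutral bound. *)
Definition dinfty (X : finType) (p q : X -> R) : R :=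
  \big[Num.max/0]_x `|p x - q x|.

Definition Dinfty (X : finType) (A B : povm X) : R :=
  sup [set dinfty (outcome_dist w A) (outcome_dist w B) | w in [set: state]].

Definition intrinsic_noise (X : finType) (A : povm X) : R :=
  \big[Num.max/0]_a opnorm (A a - A a ^+ 2).

End BoundedOperators.

(* Main.v *)
(* Write A' = f_A(F), B' = f_B(F).  The commutator is bilinear, so [A, B] is the
   sum of [A', B'], [A - A', B'], [A', B - B'] and [A - A', B - B'].  In the two
   middle terms B' and A' may be replaced by B' - 1/2 and A' - 1/2, of norm at
   most 1/2.  For the first one, put F(P) = sum_(x in P) F_x; the defects
   F(P /\ Q) - F(P) F(Q) are the matrix coefficients
     sum_x <F_x (1_Q(x) u - F(Q) u), 1_P(x) v - F(P) v>
   of a positive form (the projection 1 - V V^* of a Naimark dilation), so the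
   Cauchy-Schwarz inequality bounds them by ||A' - A'^2|| and ||B' - B'^2||; and
   [F(P), F(Q)] is a difference of two defects.  Finally, with X = A - A',
     A' - A'^2 = (A - A^2) + (A - 1/2) X + X (A' - 1/2),
   so A' - A'^2 exceeds V(A) in norm by at most ||A - A'||; and ||A - A'|| is
   the supremum over vector states since A - A' is self-adjoint. *)
Require Import Defs.
From HB Require Import structures.
From mathcomp Require Import all_boot all_order all_algebra.
From mathcomp Require Import complex.
From mathcomp Require Import boolp classical_sets functions reals.
From mathcomp Require Import topology normedtype ring lra.

Set Implicit Arguments.
Unset Strict Implicit.
Unset Printing Implicit Defensive.

Import Order.TTheory GRing.Theory Num.Theory.
Import numFieldNormedType.Exports.

Local Open Scope ring_scope.

(** * Scalar tools: equalities modulo a known equation, and a discriminant bound *)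

(** Turns a consequence of [z = t] into an identity between differences, which [ring] can check. *)
Lemma subr_eq_sub (V : zmodType) (x y z t : V) : z = t -> x - y = z - t -> x = y.
Proof. by move=> ->; rewrite subrr => /subr0_eq. Qed.

(** Discriminant argument in a complex variable: for [b != 0] evaluate at the minimiser
    [t = - c / b]; for [b = 0] the expression is affine in [t] and turns negative far along [- c]
    unless [c = 0]. *)
Lemma normC2_le_mul (C : numClosedFieldType) (a b c : C) :
    0 <= a -> 0 <= b ->
    (forall t, 0 <= a + t^* * c + t * c^* + `|t| ^+ 2 * b) ->
  `|c| ^+ 2 <= a * b.
Proof.
move=> a0 b0 quad; have [bz|bN0] := eqVneq b 0.
  have [->|cN0] := eqVneq c 0; first by rewrite bz mulr0 normr0 expr0n.
  have c2 : 0 < `|c| ^+ 2 by rewrite exprn_gt0 // normr_gt0.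
  (* With this [s] the value at [t = - s * c] is exactly -1. *)
  pose s := (a + 1) / (2 * `|c| ^+ 2).
  have s0 : 0 <= s by rewrite divr_ge0 ?addr_ge0 ?mulr_ge0 // ltW.
  have := quad (- s * c).
  rewrite bz mulr0 addr0 rmorphM rmorphN /= (geC0_conj s0) -mulrA -[_ * c * _]mulrA.
  rewrite [c^* * c]mulrC -normCK -addrA -mulrDl -mulr2n -mulr_natl mulrN mulNr.
  rewrite [2 * s]mulrC -mulrA divfK ?mulf_neq0 ?pnatr_eq0 ?normr_eq0 //.
  by rewrite opprD addrA subrr add0r oppr_ge0 ler10.
have bp : 0 < b by rewrite lt_def bN0.
have := quad (- b^-1 * c).
rewrite rmorphM rmorphN /= (geC0_conj (_ : 0 <= b^-1)) ?invr_ge0 //.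
rewrite -mulrA -[_ * c * _]mulrA [c^* * c]mulrC -normCK normrM normrN.
rewrite (ger0_norm (_ : 0 <= b^-1)) ?invr_ge0 // exprMn [_ ^+ 2 * _ * b]mulrAC.
rewrite [b^-1 ^+ 2]expr2 divfK // mulNr subrK subr_ge0 => h.
by rewrite mulrC -ler_pdivrMl.
Qed.

(** * Positive operators and the Cauchy-Schwarz inequality *)

Section PositiveOperators.
Variables (R : realType) (H : hilbertType R).
Implicit Types (S T : bop H) (u v : H) (c : R).

Lemma bop0E u : (0 : bop H) u = 0. Proof. by []. Qed.
Lemma bop1E u : (1 : bop H) u = u. Proof. by []. Qed.
Lemma bopDE S T u : (S + T) u = S u + T u. Proof. by []. Qed.
Lemma bopNE T u : (- T) u = - T u. Proof. by []. Qed.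
Lemma bopME S T u : (S * T) u = S (T u). Proof. by []. Qed.
Lemma bopZE (a : R[i]) T u : (a *: T) u = a *: T u. Proof. by []. Qed.

Lemma bop_sumE (I : finType) (P : pred I) (F : I -> bop H) u :
  (\sum_(i | P i) F i) u = \sum_(i | P i) F i u.
Proof.
elim/big_ind2: _ => // S x T y <- <-; exact: bopDE.
Qed.

Lemma bopD T u v : T (u + v) = T u + T v. Proof. exact: linearD. Qed.
Lemma bopN T u : T (- u) = - T u. Proof. exact: linearN. Qed.
Lemma bopZ T a u : T (a *: u) = a *: T u. Proof. exact: linearZ. Qed.

Definition bopE := (bop0E, bop1E, bopDE, bopNE, bopME, bopZE).

Lemma innerDl u v w : inner (u + v) w = inner u w + inner v w.
Proof. exact: linearDl. Qed.
Lemma innerDr u v w : inner u (v + w) = inner u v + inner u w.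
Proof. exact: linearDr. Qed.
Lemma innerNl u v : inner (- u) v = - inner u v.
Proof. exact: linearNl. Qed.
Lemma innerNr u v : inner u (- v) = - inner u v.
Proof. exact: linearNr. Qed.
Lemma innerZl a u v : inner (a *: u) v = a * inner u v.
Proof. exact: linearZl_LR. Qed.
Lemma innerZr a u v : inner u (a *: v) = a^* * inner u v.
Proof. exact: linearZr_LR. Qed.

(** Polarization: the quadratic form of [T] is real at [u + v] and at [u + 'i *: v], and the two
    resulting relations add up to the claim. *)
Lemma posop_herm T u v : posop T -> inner (T u) v = (inner (T v) u)^*.
Proof.
move=> T0; set s := inner (T u) v; set t := inner (T v) u.
have realq x : (inner (T x) x)^* = inner (T x) x by exact: geC0_conj.
have e1 : s^* + t^* = s + t.
  have := realq (u + v); rewrite bopD !innerDl !innerDr !rmorphD /= !realq -/s -/t.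
  by move=> E; apply: (subr_eq_sub E); ring.
have e2 : t^* - s^* = s - t.
  have := realq (u + 'i *: v).
  rewrite bopD bopZ !(innerDl, innerDr, innerZl, innerZr) !(rmorphD, rmorphM) /=.
  rewrite !conjCK !conjCi !realq -/s -/t => E.
  apply: (mulfI (neq0Ci _)); apply: (subr_eq_sub (esym E)); ring.
apply: (mulfI (_ : 2 != 0)); first by rewrite pnatr_eq0.
apply: (subr_eq_sub (esym (congr2 +%R e1 e2))); ring.
Qed.

(** The sum is a positive semidefinite form on families of vectors; its value at [u + t v] is the
    quadratic in [t] of the discriminant bound. *)
Lemma posop_CauchySchwarz (I : finType) (F : I -> bop H) (u v : I -> H) :
    (forall i, posop (F i)) ->
  `|\sum_i inner (F i (u i)) (v i)| ^+ 2 <=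
    (\sum_i inner (F i (u i)) (u i)) * \sum_i inner (F i (v i)) (v i).
Proof.
move=> F0; apply: normC2_le_mul; try by apply: sumr_ge0 => i _; exact: F0.
move=> t; rewrite rmorph_sum !mulr_sumr -!big_split /=.
apply: sumr_ge0 => i _; have := F0 i (u i + t *: v i).
rewrite bopD bopZ !(innerDl, innerDr, innerZl, innerZr) -(posop_herm _ _ (F0 i)).
by rewrite normCK mulrA -!addrA.
Qed.

Lemma inner_ge0 u : 0 <= inner u u.
Proof. by rewrite inner_norm exprn_ge0. Qed.

Lemma inner_le_norm u v : `|inner u v| <= `|u| * `|v|.
Proof.
have := @posop_CauchySchwarz 'I_1 (fun=> 1) (fun=> u) (fun=> v) (fun=> inner_ge0).
rewrite !big_ord1 !inner_norm -exprMn.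
by rewrite ler_sqr // nnegrE ?mulr_ge0.
Qed.

End PositiveOperators.

(** * The operator norm and its relation to the operator order *)

Section OperatorNorm.
Variables (R : realType) (H : hilbertType R).
Implicit Types (S T : bop H) (u v : H) (c : R).
Local Notation "x %:C" := (real_complex R x) (format "x %:C").

Lemma Re_normE u : (complex.Re `|u|)%:C = `|u|.
Proof. by apply: RRe_real; apply: normr_real. Qed.

(** As [M * |u|] is nonnegative, it equals its own modulus, so [|M|] is a bound too. *)
Lemma bop_bounded_real T : exists M : R, forall u, `|T u| <= M%:C * `|u|.
Proof.
have [M TM] := bop_bounded T; exists (complex.Re `|M|) => u.
rewrite RRe_real ?normr_real // -[`|u|]normr_id -normrM.
by rewrite ger0_norm // (le_trans _ (TM u)).
Qed.

Lemma opnorm_le T c :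
  0 <= c -> (forall u, `|T u| <= c%:C * `|u|) -> opnorm T <= c.
Proof.
move=> c0 Tc; apply: ge_sup.
  by exists (complex.Re `|T 0|), 0; rewrite /= ?normr0.
move=> _ [u /= u1 <-]; rewrite -lecR Re_normE (le_trans (Tc u)) //.
by rewrite ler_piMr // ler0c.
Qed.

Lemma opnorm_ub T u : `|u| <= 1 -> complex.Re `|T u| <= opnorm T.
Proof.
move=> u1; apply: ub_le_sup; last by exists u.
(* [M] has no prescribed sign; the maximum with 0 allows [|w| <= 1] to be used. *)
have [M TM] := bop_bounded_real T; exists (Num.max 0 M) => _ [w /= w1 <-].
rewrite -lecR Re_normE (le_trans (TM w)) //.
rewrite (@le_trans _ _ ((Num.max 0 M)%:C * `|w|)) //.
  by rewrite ler_wpM2r // lecR le_max lexx orbT.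
by rewrite ler_piMr // ler0c le_max lexx.
Qed.

Lemma opnorm_ge0 T : 0 <= opnorm T.
Proof. by have := @opnorm_ub T 0; rewrite linear0 !normr0 /=; apply. Qed.

Lemma bop_le_opnorm T u : `|T u| <= (opnorm T)%:C * `|u|.
Proof.
have [->|u0] := eqVneq u 0; first by rewrite linear0 !normr0 mulr0.
have nu : 0 < `|u| by rewrite normr_gt0.
have := @opnorm_ub T (`|u|^-1 *: u); rewrite bopZ !normrZ normfV normr_id.
rewrite mulVf ?gt_eqF // => /(_ (lexx _)); rewrite -lecR RRe_real.
  by rewrite ler_pdivrMl // mulrC.
by rewrite ger0_real // mulr_ge0 // invr_ge0.
Qed.

Lemma opnormD S T : opnorm (S + T) <= opnorm S + opnorm T.
Proof.
apply: opnorm_le => [|u]; first by rewrite addr_ge0 // opnorm_ge0.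
rewrite bopE (le_trans (ler_normD _ _)) // rmorphD mulrDl.
by rewrite lerD // bop_le_opnorm.
Qed.

Lemma opnormN T : opnorm (- T) = opnorm T.
Proof. by congr sup; apply: eq_imagel => u _; rewrite bopE normrN. Qed.

Lemma opnormB S T : opnorm (S - T) <= opnorm S + opnorm T.
Proof. by rewrite -(opnormN T) opnormD. Qed.

Lemma opnormM S T : opnorm (S * T) <= opnorm S * opnorm T.
Proof.
apply: opnorm_le => [|u]; first by rewrite mulr_ge0 // opnorm_ge0.
rewrite bopE (le_trans (bop_le_opnorm _ _)) // rmorphM -mulrA.
by rewrite ler_wpM2l ?bop_le_opnorm // ler0c opnorm_ge0.
Qed.

Lemma opnorm_commutator S T : opnorm (commutator S T) <= 2 * (opnorm S * opnorm T).
Proof.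
rewrite (le_trans (opnormB _ _)) // mulr_natl mulr2n lerD ?opnormM //.
by rewrite mulrC opnormM.
Qed.

Lemma opnorm_le_inner T c : 0 <= c ->
  (forall u v, `|inner (T u) v| <= c%:C * (`|u| * `|v|)) -> opnorm T <= c.
Proof.
move=> c0 Tc; apply: opnorm_le => // u.
have [->|Tu0] := eqVneq (T u) 0; first by rewrite normr0 mulr_ge0 ?ler0c.
rewrite -(ler_pM2r (_ : 0 < `|T u|)) ?normr_gt0 // -mulrA -expr2 -inner_norm.
by rewrite -[leLHS]ger0_norm ?inner_ge0.
Qed.

(** Cauchy-Schwarz for the two operators [c + T] and [c - T], at the pairs [(u, v)] and [(u, - v)]:
    the mixed terms add up to twice [inner (T u) v], and [T] cancels from the diagonal ones. *)
Lemma posop_opnorm T c : 0 <= c ->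
  posop (c%:C *: (1 : bop H) + T) -> posop (c%:C *: (1 : bop H) - T) ->
  opnorm T <= c.
Proof.
move=> c0 Tp Tn; apply: opnorm_le_inner => // u v.
pose F b := if b then c%:C *: (1 : bop H) + T else c%:C *: (1 : bop H) - T.
have F0 b : posop (F b) by case: b.
have := posop_CauchySchwarz (fun=> u) (fun b => if b then v else - v) F0.
rewrite !big_bool /= !(bopN, innerDl, innerZl, innerNl, innerNr, opprK).
rewrite !inner_norm => h.
have {}h : `|2 * inner (T u) v| ^+ 2 <= (2 * (c%:C * (`|u| * `|v|))) ^+ 2.
  by apply: etrans h; congr (_ <= _); [congr (`| _ | ^+ 2)|]; ring.
have ge0 : 0 <= 2 * (c%:C * (`|u| * `|v|)) by rewrite !mulr_ge0 ?ler0c.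
move: h; rewrite ler_sqr ?nnegrE //.
by rewrite normrM [`|2|]ger0_norm // ler_pM2l ?ltr0n.
Qed.

Lemma inner_le_opnorm T u : `|inner (T u) u| <= (opnorm T)%:C * `|u| ^+ 2.
Proof.
rewrite (le_trans (inner_le_norm _ _)) // expr2 mulrA ler_wpM2r //.
exact: bop_le_opnorm.
Qed.

Lemma posop_unit T :
  (forall e, `|e| = 1 -> 0 <= inner (T e) e) -> posop T.
Proof.
move=> Te u; have [->|u0] := eqVneq u 0; first by rewrite linear0r.
have nu : `|u| != 0 by rewrite normr_eq0.
rewrite -[u](scalerKV nu) bopZ innerZl innerZr mulrA -normCK.
rewrite mulr_ge0 ?exprn_ge0 ?Te // normrZ normfV normr_id mulVf //.
Qed.

End OperatorNorm.

(** * Commutators with effects, and how unsharpness varies *)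

Section Commutators.
Variables (R : realType) (H : hilbertType R).
Implicit Types (S T E : bop H).
Local Notation "x %:C" := (real_complex R x) (format "x %:C").

Lemma commutatorDl S T E : commutator (S + T) E = commutator S E + commutator T E.
Proof. by rewrite /commutator mulrDl mulrDr opprD addrACA. Qed.

Lemma commutatorC S T : commutator S T = - commutator T S.
Proof. by rewrite opprB. Qed.

Lemma commutatorDr S T E : commutator S (T + E) = commutator S T + commutator S E.
Proof. by rewrite /commutator mulrDl mulrDr opprD addrACA. Qed.

Lemma bop_mulZ1l a T : (a *: (1 : bop H)) * T = a *: T.
Proof. exact: bop_ext. Qed.

Lemma bop_mulZ1r a T : T * (a *: (1 : bop H)) = a *: T.
Proof. by apply: bop_ext => u; rewrite bopE bopZ. Qed.

Lemma commutatorZ1r S a : commutator S (a *: (1 : bop H)) = 0.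
Proof. by rewrite /commutator bop_mulZ1l bop_mulZ1r subrr. Qed.

Let half : bop H := 2^-1 *: (1 : bop H).

Let halfD : half + half = 1.
Proof. by rewrite -scalerDl -[2^-1]mul1r -splitr scale1r. Qed.

(** Subtracting 1/2 makes the order interval from 0 to 1 symmetric about 0. *)
Lemma effect_opnorm_half E :
  leop 0 E -> leop E 1 -> opnorm (E - half) <= 2^-1.
Proof.
rewrite /leop subr0 => E0 E1; apply: posop_opnorm; first by rewrite invr_ge0.
  by rewrite fmorphV rmorph_nat addrC subrK.
by rewrite fmorphV rmorph_nat opprB addrA halfD.
Qed.

(* Centering an effect at 1/2 halves its norm, which saves a factor 2. *)
Lemma opnorm_commutator_effect S E :
  leop 0 E -> leop E 1 -> opnorm (commutator S E) <= opnorm S.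
Proof.
move=> E0 E1; rewrite -(subrK half E) commutatorDr commutatorZ1r addr0.
rewrite (le_trans (opnorm_commutator _ _)) // mulrCA ler_piMr ?opnorm_ge0 //.
by rewrite -ler_pdivlMl // mulr1 effect_opnorm_half.
Qed.

Lemma opnorm_unsharpness_le S T : leop 0 S -> leop S 1 -> leop 0 T -> leop T 1 ->
  opnorm (T - T ^+ 2) <= opnorm (S - T) + opnorm (S - S ^+ 2).
Proof.
move=> S0 S1 T0 T1; set X := S - T.
have -> : T - T ^+ 2 = (S - half) * X + X * (T - half) + (S - S ^+ 2).
  (* [S X + X T] telescopes to the difference of squares; the two halves contribute [- X]. *)
  have -> : (S - half) * X + X * (T - half) = S ^+ 2 - T ^+ 2 - X.
    rewrite mulrBl [X * _]mulrBr addrACA -opprD bop_mulZ1l bop_mulZ1r -scalerDl.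
    rewrite -[2^-1]mul1r -splitr scale1r; congr (_ - X).
    by rewrite mulrBr mulrBl addrA subrK !expr2.
  by rewrite /X opprB [RHS]addrC !addrA subrK [RHS]addrC !addrA addNr add0r addrC.
rewrite (le_trans (opnormD _ _)) // lerD2r (le_trans (opnormD _ _)) //.
rewrite (splitr (opnorm X)) lerD // (le_trans (opnormM _ _)) //.
  by rewrite mulrC ler_wpM2l ?opnorm_ge0 ?effect_opnorm_half.
by rewrite ler_wpM2l ?opnorm_ge0 ?effect_opnorm_half.
Qed.

End Commutators.

(** * Multiplicativity defects of a POVM on events *)

Section JointMeasurement.
Variables (R : realType) (H : hilbertType R) (X : finType) (F : povm H X).
Implicit Types (p q : pred X) (u v : H).
Local Notation "x %:C" := (real_complex R x) (format "x %:C").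

(** The effect F(P) of an event. Indexing by predicates makes intersections available and covers the
    effects of every pushforward. *)
Let coarse p : bop H := \sum_(x | p x) F x.

Lemma inner_sum_povm u v : \sum_x inner (F x u) v = inner u v.
Proof. by rewrite -linear_sumlz -bop_sumE effect_sum. Qed.

Lemma inner_sum_coarse p u v :
  \sum_x (p x)%:R * inner (F x u) v = inner (coarse p u) v.
Proof.
rewrite bop_sumE linear_sumlz [RHS]big_mkcond /=; apply: eq_bigr => x _.
by case: (p x); rewrite ?mul1r ?mul0r.
Qed.

(** Of the four terms of the expansion, the two containing both [coarse q u] and [coarse p v] cancel
    because the effects sum to 1. *)
Lemma inner_coarse_defect p q u v :
  \sum_x inner (F x ((q x)%:R *: u - coarse q u)) ((p x)%:R *: v - coarse p v) =
  inner ((coarse (predI p q) - coarse p * coarse q) u) v.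
Proof.
rewrite !bopE innerDl innerNl -inner_sum_coarse.
under eq_bigr => x _.
  rewrite bopD bopN bopZ innerDl innerNl innerZl !innerDr !innerNr !innerZr.
  rewrite conjC_nat mulrBr opprB mulrA -natrM mulnb andbC; over.
rewrite !big_split /= !sumrN inner_sum_povm inner_sum_coarse.
by rewrite !inner_sum_coarse addrA subrK.
Qed.

Let defect p q : bop H := coarse (predI p q) - coarse p * coarse q.

Lemma opnorm_coarse_defect p q :
  opnorm (defect p q) <= Num.sqrt (opnorm (coarse p - coarse p ^+ 2)) *
                         Num.sqrt (opnorm (coarse q - coarse q ^+ 2)).
Proof.
(* On the diagonal the defect is the unsharpness of F(P), since an event meets itself in itself. *)
have diag r u : inner (defect r r u) u = inner ((coarse r - coarse r ^+ 2) u) u.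
  congr (inner ((_ - _ : bop H) u) u).
  by apply: eq_bigl => x; rewrite /= andbb.
apply: opnorm_le_inner => [|u v]; first by rewrite mulr_ge0 ?sqrtr_ge0.
have := posop_CauchySchwarz (fun x => (q x)%:R *: u - coarse q u)
  (fun x => (p x)%:R *: v - coarse p v) (povm_posop F).
rewrite !inner_coarse_defect -!/(defect _ _) !diag => CS.
rewrite -ler_sqr ?nnegrE ?normr_ge0 //; last first.
  by rewrite !mulr_ge0 // ler0c mulr_ge0 ?sqrtr_ge0.
apply: le_trans CS _; rewrite mulrC rmorphM !exprMn -!rmorphXn.
rewrite !sqr_sqrtr ?opnorm_ge0 // [`|u| ^+ 2 * _]mulrC mulrACA.
have le r w : inner ((coarse r - coarse r ^+ 2) w) w <=
    (opnorm (coarse r - coarse r ^+ 2))%:C * `|w| ^+ 2.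
  apply: le_trans (inner_le_opnorm _ _); rewrite ger0_norm // -diag.
  rewrite -inner_coarse_defect; apply: sumr_ge0 => x _; exact: povm_posop.
have ge0 r w : 0 <= inner ((coarse r - coarse r ^+ 2) w) w.
  rewrite -diag -inner_coarse_defect; apply: sumr_ge0 => x _; exact: povm_posop.
by apply: ler_pM; rewrite ?ge0 ?le.
Qed.

Lemma opnorm_commutator_coarse p q :
  opnorm (commutator (coarse p) (coarse q)) <=
    2 * Num.sqrt (opnorm (coarse p - coarse p ^+ 2)) *
        Num.sqrt (opnorm (coarse q - coarse q ^+ 2)).
Proof.
have -> : commutator (coarse p) (coarse q) = defect q p - defect p q.
  (* Intersection is symmetric, so only the two products survive in the difference. *)
  rewrite /defect (_ : coarse (predI q p) = coarse (predI p q)); last first.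
    by apply: eq_bigl => x; rewrite /= andbC.
  by rewrite opprB [RHS]addrC addrA addrNK.
rewrite (le_trans (opnormB _ _)) // -mulrA mulr_natl mulr2n lerD //.
  by rewrite mulrC opnorm_coarse_defect.
exact: opnorm_coarse_defect.
Qed.

End JointMeasurement.

(** * Vector states and the distance between POVMs *)

Section Distance.
Variables (R : realType) (H : hilbertType R).
Implicit Types (S T : bop H) (u v : H).
Local Notation "x %:C" := (real_complex R x) (format "x %:C").

Section VectorState.
Variables (e : H) (e1 : `|e| = 1).
(** Named separately so that it can carry the linear structure that [state] requires. *)
Definition vector_form T : R[i] := inner (T e) e.

Fact vector_form_scalar : scalar vector_form.
Proof. by move=> a S T; rewrite /vector_form !bopE innerDl innerZl. Qed.

HB.instance Definition _ :=
  GRing.isLinear.Build R[i] (bop H) R[i] *%R vector_form vector_form_scalar.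

Fact vector_form_ge0 T : posop T -> 0 <= vector_form T.
Proof. exact. Qed.

Fact vector_form1 : vector_form 1 = 1.
Proof. by rewrite /vector_form inner_norm e1 expr1n. Qed.

Definition vector_state : state H := State vector_form_ge0 vector_form1.
End VectorState.

Lemma outcome_dist_ge0 (w : state H) (X : finType) (A : povm H X) a :
  0 <= outcome_dist w A a.
Proof.
have := state_ge0 w (povm_posop A a).
by rewrite lecE => /andP[].
Qed.

Lemma outcome_dist_le1 (w : state H) (X : finType) (A : povm H X) a :
  outcome_dist w A a <= 1.
Proof.
have := state_ge0 w (effect_le1 A a); rewrite linearB /= state1 subr_ge0.
by rewrite lecE => /andP[].
Qed.

(** Bounds the set whose supremum is [Dinfty], so that this supremum is a genuine upper bound. *)
Lemma dinfty_le1 (w : state H) (X : finType) (A B : povm H X) :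
  dinfty (outcome_dist w A) (outcome_dist w B) <= 1.
Proof.
apply: bigmax_le => // a _.
have := (outcome_dist_ge0 w A a, outcome_dist_ge0 w B a).
have := (outcome_dist_le1 w A a, outcome_dist_le1 w B a).
by move=> [? ?] [? ?]; rewrite ler_norml; apply/andP; split; lra.
Qed.

Lemma dinfty_le_Dinfty (w : state H) (X : finType) (A B : povm H X) :
  dinfty (outcome_dist w A) (outcome_dist w B) <= Dinfty A B.
Proof.
apply: ub_le_sup; last by exists w.
by exists 1 => _ [w' _ <-]; exact: dinfty_le1.
Qed.

Lemma Dinfty_ge0 (X : finType) (A B : povm H X) : 0 <= Dinfty A B.
Proof.
have [[w]|nostate] := pselect (inhabited (state H)).
  by rewrite (le_trans _ (dinfty_le_Dinfty w A B)) // bigmax_ge_id.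
(* Without any state the set is empty and [sup] takes its default value 0. *)
by rewrite /Dinfty sup_out // => -[[r [w _ _]] _]; apply: nostate.
Qed.

(** Vector states show that the quadratic form of [A a - B a] on unit vectors is real and lies
    between [- Dinfty A B] and [Dinfty A B]; these order bounds control the norm. *)
Lemma opnorm_le_Dinfty (X : finType) (A B : povm H X) a :
  opnorm (A a - B a) <= Dinfty A B.
Proof.
have numrange e : `|e| = 1 ->
    exists2 r : R, inner ((A a - B a) e) e = r%:C & `|r| <= Dinfty A B.
  move=> e1; pose w := vector_state e1.
  exists (outcome_dist w A a - outcome_dist w B a).
    rewrite !bopE innerDl innerNl rmorphB /= !RRe_real //.
      by rewrite ger0_real //; exact: povm_posop.
    by rewrite ger0_real //; exact: povm_posop.
  apply: le_trans (dinfty_le_Dinfty w A B).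
  exact: (le_bigmax _ (fun b => `|outcome_dist w A b - outcome_dist w B b|) a).
apply: posop_opnorm; first exact: Dinfty_ge0.
  apply: posop_unit => e e1; have [r re rD] := numrange _ e1.
  rewrite bopDE innerDl re bopZE innerZl inner_norm e1 expr1n mulr1 -rmorphD ler0c.
  by move: rD; rewrite ler_norml => /andP[? _]; lra.
apply: posop_unit => e e1; have [r re rD] := numrange _ e1.
rewrite bopDE bopNE innerDl innerNl re bopZE innerZl inner_norm e1 expr1n mulr1.
by rewrite -rmorphB ler0c; move: rD; rewrite ler_norml => /andP[_ ?]; lra.
Qed.

End Distance.

(** * The trade-off inequality, assembled from four commutators *)

Theorem theorem1 (R : realType) (H : hilbertType R)
    (H_neq0 : exists x : H, x != 0)
    (XA XB X : finType) (A : povm H XA) (B : povm H XB) (F : povm H X)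
    (fA : X -> XA) (fB : X -> XB) :
  \big[Num.max/0]_(ab : XA * XB) opnorm (commutator (A ab.1) (B ab.2)) <=
    2 * Dinfty A (pushforward fA F) * Dinfty B (pushforward fB F)
    + Dinfty A (pushforward fA F) + Dinfty B (pushforward fB F)
    + 2 * Num.sqrt (2 * Dinfty A (pushforward fA F) + intrinsic_noise A)
        * Num.sqrt (2 * Dinfty B (pushforward fB F) + intrinsic_noise B).
Proof.
set A' := pushforward fA F; set B' := pushforward fB F.
(* The comparison of unsharpness yields one distance plus the intrinsic noise, and the distance is
   nonnegative. *)
have noise (Y : finType) (E E' : povm H Y) y :
    opnorm (E' y - E' y ^+ 2) <= 2 * Dinfty E E' + intrinsic_noise E.
  have := Dinfty_ge0 E E'; have := opnorm_le_Dinfty E E' y.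
  have := opnorm_unsharpness_le (effect_ge0 E y) (effect_le1 E y)
    (effect_ge0 E' y) (effect_le1 E' y).
  have : opnorm (E y - E y ^+ 2) <= intrinsic_noise E.
    exact: (le_bigmax _ (fun y => opnorm (E y - E y ^+ 2)) y).
  by move=> ? ? ? ?; lra.
have DA0 := Dinfty_ge0 A A'; have DB0 := Dinfty_ge0 B B'.
apply: bigmax_le => [|[a b] _ /=].
  (* The right-hand side must also dominate the default 0 of the maximum. *)
  by rewrite !addr_ge0 ?mulr_ge0 ?sqrtr_ge0.
have DA := opnorm_le_Dinfty A A' a; have DB := opnorm_le_Dinfty B B' b.
rewrite -(subrK (A' a) (A a)) -(subrK (B' b) (B b)).
move: (A a - A' a) (B b - B' b) DA DB => S T DS DT.
have cST : opnorm (commutator S T) <= 2 * Dinfty A A' * Dinfty B B'.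
  rewrite (le_trans (opnorm_commutator _ _)) // -mulrA ler_wpM2l //.
  by rewrite ler_pM ?opnorm_ge0.
have cSB : opnorm (commutator S (B' b)) <= Dinfty A A'.
  apply: le_trans DS.
  by apply: opnorm_commutator_effect; [exact: effect_ge0 | exact: effect_le1].
have cAT : opnorm (commutator (A' a) T) <= Dinfty B B'.
  rewrite commutatorC opnormN; apply: le_trans DT.
  by apply: opnorm_commutator_effect; [exact: effect_ge0 | exact: effect_le1].
(* The effects of the two pushforwards are those of the preimage events of [a] and [b] under [F]. *)
have cAB := opnorm_commutator_coarse F (fun x => fA x == a) (fun x => fB x == b).
have {}cAB : opnorm (commutator (A' a) (B' b)) <=
    2 * Num.sqrt (2 * Dinfty A A' + intrinsic_noise A)
      * Num.sqrt (2 * Dinfty B B' + intrinsic_noise B).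
  apply: le_trans cAB _.
  apply: ler_pM; rewrite ?mulr_ge0 ?sqrtr_ge0 //.
    by rewrite ler_wpM2l //; apply/ler_wsqrtr/(noise _ A A').
  exact/ler_wsqrtr/(noise _ B B').
rewrite commutatorDl !commutatorDr.
apply: le_trans (opnormD _ _) _.
apply: le_trans (lerD (opnormD _ _) (opnormD _ _)) _.
lra.
Qed.
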